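(* Let $\mathfrak{F}$ be a surface in $E^3$ of class $C^r$, $r\ge 4$, without parabolic points, which is not a canal surface and not a moulding surface, with principal curvatures $k_1,k_2$ and geodesic curvatures $q_1,q_2$ of the lines of curvature. Consider the two nets on $\mathfrak{F}$ corresponding to the lines of curvature of the central surfaces $\mathfrak{F}^{(1)}$ and $\mathfrak{F}^{(2)}$, respectively, namely $$q_1\nabla_1k_1\,\omega_1^2+\bigl[k_1^2(k_1-k_2)+q_2\nabla_1k_1+q_1\nabla_2k_1\bigr]\omega_1\omega_2+q_2\nabla_2k_1\,\omega_2^2=0$$ and $$q_1\nabla_1k_2\,\omega_1^2+\bigl[k_2^2(k_1-k_2)+q_2\nabla_1k_2+q_1\nabla_2k_2\bigr]\omega_1\omega_2+q_2\nabla_2k_2\,\omega_2^2=0 .$$ These nets are both (a) orthogonal if and only if $\mathfrak{F}$ is a surface of constant mean curvature, and (b) conjugate if and only if $\mathfrak{F}$ is a surface of constant Gaussian curvature.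
   Context: Setting. $\bar x(u,v)$ is a parametric representation of $\mathfrak{F}$ over a connected domain. $\{\bar e_1,\bar e_2,\bar e_3\}$ is the orthonormal moving frame with $\bar e_1,\bar e_2$ the principal directions, $\bar e_3$ the unit normal, $\det(\bar e_1,\bar e_2,\bar e_3)=1$. The linear differential forms $\omega_1,\omega_2,\omega_{ij}$ are defined by $d\bar x=\omega_1\bar e_1+\omega_2\bar e_2$, $d\bar e_i=\sum_{j}\omega_{ij}\bar e_j$ ($\omega_{ij}=-\omega_{ji}$), and $\omega_{31}=-k_1\omega_1$, $\omega_{32}=-k_2\omega_2$, $\omega_{12}=q_1\omega_1+q_2\omega_2$, where $k_1,k_2$ are the principal curvatures and $q_1,q_2$ the geodesic curvatures of the lines of curvature. For a function $f$, the Pfaffian derivatives $\nabla_1 f,\nabla_2 f$ are defined by $df=\nabla_1 f\,\omega_1+\nabla_2 f\,\omega_2$. Standing assumptions. $\mathfrak{F}$ has no parabolic points: $k_1k_2\neq 0$ everywhere. $\mathfrak{F}$ is not a canal surface, so that the central surfaces do not degenerate into curves; this is used in the form $k_1\neq k_2$, $\nabla_1k_1\neq 0$ and $\nabla_2k_2\neq0$ everywhere. Moulding surfaces. A moulding surface is a surface generated by the orthogonal trajectories of a one-parameter family of planes; this is the case where $q_1$ vanishes identically or $q_2$ vanishes identically. Central surfaces. $\mathfrak{F}^{(i)}$, $i=1,2$, is the surface parametrized by $\bar y^{(i)}=\bar x+\frac{1}{k_i}\bar e_3$; points of $\mathfrak{F}$ and $\mathfrak{F}^{(i)}$ with the same parameters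 $(u,v)$ correspond to each other. Nets. A net on $\mathfrak{F}$ is given by a quadratic differential equation $A\,\omega_1^2+2B\,\omega_1\omega_2+C\,\omega_2^2=0$. It is orthogonal if its two directions are orthogonal with respect to the first fundamental form $\omega_1^2+\omega_2^2$, i.e. $A+C=0$; it is conjugate if its two directions are conjugate with respect to the second fundamental form $k_1\omega_1^2+k_2\omega_2^2$, i.e. $k_2A+k_1C=0$ (identically on $\mathfrak{F}$). The mean curvature is $\frac12(k_1+k_2)$ and the Gaussian curvature is $k_1k_2$. *)

(* Defs.v *)
From Stdlib Require Import Reals Lra.
From Coquelicot Require Import Coquelicot.

Open Scope R_scope.

Notation vec := (R * R * R)%type.

Definition dot (a b : vec) : R :=
  fst (fst a) * fst (fst b) + snd (fst a) * snd (fst b) + snd a * snd b.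

Definition cross (a b : vec) : vec :=
  (snd (fst a) * snd b - snd a * snd (fst b),
   snd a * fst (fst b) - fst (fst a) * snd b,
   fst (fst a) * snd (fst b) - snd (fst a) * fst (fst b)).

Definition det3 (a b c : vec) : R := dot (cross a b) c.

Definition normalize (a : vec) : vec := scal (/ sqrt (dot a a)) a.

(* The parameter domain D is a set of pairs, while functions of the parameters
   (u, v) are curried, as in Coquelicot's Derive_2d. *)

Definition connected (D : R * R -> Prop) : Prop :=
  forall U V : R * R -> Prop, open U -> open V ->
    (forall p, D p -> U p \/ V p) ->
    (exists p, D p /\ U p) -> (exists p, D p /\ V p) ->
    exists p, D p /\ U p /\ V p.

(* ex_diff_n f n u v: the partial derivatives of f of order <= n exist at (u, v)
   and are continuous there; on an open set this is the class C^n. *)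
Definition class_C (n : nat) (D : R * R -> Prop) (f : R -> R -> R) : Prop :=
  forall u v, D (u, v) -> ex_diff_n f n u v.

Definition vclass_C (n : nat) (D : R * R -> Prop) (X : R -> R -> vec) : Prop :=
  class_C n D (fun u v => fst (fst (X u v))) /\
  class_C n D (fun u v => snd (fst (X u v))) /\
  class_C n D (fun u v => snd (X u v)).

(* A differential form is its value at (u, v) on the parameter vector
   h = (du, dv). *)
Definition form := R -> R -> R * R -> R.

Definition diff (f : R -> R -> R) : form := fun u v h =>
  Derive (fun z => f z v) u * fst h + Derive (fun z => f u z) v * snd h.

Definition vdiff (X : R -> R -> vec) (u v : R) (h : R * R) : vec :=
  (diff (fun a b => fst (fst (X a b))) u v h,
   diff (fun a b => snd (fst (X a b))) u v h,
   diff (fun a b => snd (X a b)) u v h).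

Definition du : R * R := (1, 0).
Definition dv : R * R := (0, 1).

Definition immersed (D : R * R -> Prop) (X : R -> R -> vec) : Prop :=
  forall u v, D (u, v) -> cross (vdiff X u v du) (vdiff X u v dv) <> zero.

(* A regular surface of class C^r together with its principal moving frame.
   Of the forms w_ij with d e_i = sum_j w_ij e_j and w_ij = - w_ji, the
   independent ones w12, w31, w32 are kept.  The principal directions of a C^r
   surface without umbilics are fields of class C^(r-2). *)
Record surface (r : nat) := Surface {
  dom : R * R -> Prop;
  pos : R -> R -> vec;
  e1 : R -> R -> vec;
  e2 : R -> R -> vec;
  e3 : R -> R -> vec;
  w1 : form;
  w2 : form;
  w12 : form;
  w31 : form;
  w32 : form;
  k1 : R -> R -> R;
  k2 : R -> R -> R;
  q1 : R -> R -> R;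
  q2 : R -> R -> R;
  dom_open : open dom;
  dom_connected : connected dom;
  dom_nonempty : exists p, dom p;
  pos_class : vclass_C r dom pos;
  pos_immersed : immersed dom pos;
  e1_class : vclass_C (r - 2) dom e1;
  e2_class : vclass_C (r - 2) dom e2;
  e3_class : vclass_C (r - 2) dom e3;
  frame_orthonormal : forall u v, dom (u, v) ->
    dot (e1 u v) (e1 u v) = 1 /\ dot (e2 u v) (e2 u v) = 1 /\
    dot (e3 u v) (e3 u v) = 1 /\ dot (e1 u v) (e2 u v) = 0 /\
    dot (e1 u v) (e3 u v) = 0 /\ dot (e2 u v) (e3 u v) = 0;
  frame_det : forall u v, dom (u, v) -> det3 (e1 u v) (e2 u v) (e3 u v) = 1;
  d_pos : forall u v h, dom (u, v) ->
    vdiff pos u v h = plus (scal (w1 u v h) (e1 u v)) (scal (w2 u v h) (e2 u v));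
  d_e1 : forall u v h, dom (u, v) ->
    vdiff e1 u v h =
      plus (scal (w12 u v h) (e2 u v)) (scal (- w31 u v h) (e3 u v));
  d_e2 : forall u v h, dom (u, v) ->
    vdiff e2 u v h =
      plus (scal (- w12 u v h) (e1 u v)) (scal (- w32 u v h) (e3 u v));
  d_e3 : forall u v h, dom (u, v) ->
    vdiff e3 u v h =
      plus (scal (w31 u v h) (e1 u v)) (scal (w32 u v h) (e2 u v));
  w31E : forall u v h, dom (u, v) -> w31 u v h = - k1 u v * w1 u v h;
  w32E : forall u v h, dom (u, v) -> w32 u v h = - k2 u v * w2 u v h;
  w12E : forall u v h, dom (u, v) ->
    w12 u v h = q1 u v * w1 u v h + q2 u v * w2 u v h
}.

Arguments dom {r}. Arguments pos {r}.
Arguments e1 {r}. Arguments e2 {r}. Arguments e3 {r}.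
Arguments w1 {r}. Arguments w2 {r}. Arguments w12 {r}.
Arguments w31 {r}. Arguments w32 {r}.
Arguments k1 {r}. Arguments k2 {r}. Arguments q1 {r}. Arguments q2 {r}.

Definition area {r} (F : surface r) (u v : R) : R :=
  w1 F u v du * w2 F u v dv - w1 F u v dv * w2 F u v du.

(* Pfaffian derivatives: Cramer's solution of
   df = (nabla1 F f) w1 + (nabla2 F f) w2; see nabla_spec and nabla_unique. *)
Definition nabla1 {r} (F : surface r) (f : R -> R -> R) (u v : R) : R :=
  (diff f u v du * w2 F u v dv - diff f u v dv * w2 F u v du) / area F u v.

Definition nabla2 {r} (F : surface r) (f : R -> R -> R) (u v : R) : R :=
  (w1 F u v du * diff f u v dv - w1 F u v dv * diff f u v du) / area F u v.

Definition no_parabolic_points {r} (F : surface r) : Prop :=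
  forall u v, dom F (u, v) -> k1 F u v * k2 F u v <> 0.

Definition not_canal {r} (F : surface r) : Prop :=
  forall u v, dom F (u, v) ->
    k1 F u v <> k2 F u v /\
    nabla1 F (k1 F) u v <> 0 /\ nabla2 F (k2 F) u v <> 0.

Definition moulding {r} (F : surface r) : Prop :=
  (forall u v, dom F (u, v) -> q1 F u v = 0) \/
  (forall u v, dom F (u, v) -> q2 F u v = 0).

Definition central1 {r} (F : surface r) (u v : R) : vec :=
  plus (pos F u v) (scal (/ k1 F u v) (e3 F u v)).

Definition central2 {r} (F : surface r) (u v : R) : vec :=
  plus (pos F u v) (scal (/ k2 F u v) (e3 F u v)).

Definition unit_normal (Y : R -> R -> vec) (u v : R) : vec :=
  normalize (cross (vdiff Y u v du) (vdiff Y u v dv)).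

(* h is tangent to a line of curvature of the surface Y at (u, v) (Rodrigues);
   h = 0 is not excluded. *)
Definition principal_direction (Y : R -> R -> vec) (u v : R) (h : R * R) : Prop :=
  exists k : R, vdiff (unit_normal Y) u v h = scal (- k) (vdiff Y u v h).

(* The net A w1^2 + 2 B w1 w2 + C w2^2 = 0; see net_directions for
   orthogonal_net and conjugate_net. *)
Record net := Net { netA : R -> R -> R; netB : R -> R -> R; netC : R -> R -> R }.

Definition net_eq {r} (F : surface r) (N : net) (u v : R) (h : R * R) : Prop :=
  netA N u v * w1 F u v h ^ 2 + 2 * netB N u v * (w1 F u v h * w2 F u v h)
  + netC N u v * w2 F u v h ^ 2 = 0.

Definition orthogonal_net {r} (F : surface r) (N : net) : Prop :=
  forall u v, dom F (u, v) -> netA N u v + netC N u v = 0.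

Definition conjugate_net {r} (F : surface r) (N : net) : Prop :=
  forall u v, dom F (u, v) ->
    k2 F u v * netA N u v + k1 F u v * netC N u v = 0.

Definition net1 {r} (F : surface r) : net := Net
  (fun u v => q1 F u v * nabla1 F (k1 F) u v)
  (fun u v => (k1 F u v ^ 2 * (k1 F u v - k2 F u v)
     + q2 F u v * nabla1 F (k1 F) u v + q1 F u v * nabla2 F (k1 F) u v) / 2)
  (fun u v => q2 F u v * nabla2 F (k1 F) u v).

Definition net2 {r} (F : surface r) : net := Net
  (fun u v => q1 F u v * nabla1 F (k2 F) u v)
  (fun u v => (k2 F u v ^ 2 * (k1 F u v - k2 F u v)
     + q2 F u v * nabla1 F (k2 F) u v + q1 F u v * nabla2 F (k2 F) u v) / 2)
  (fun u v => q2 F u v * nabla2 F (k2 F) u v).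

Definition lines_of_curvature_net {r} (F : surface r) (N : net)
    (Y : R -> R -> vec) : Prop :=
  forall u v h, dom F (u, v) ->
    (principal_direction Y u v h <-> net_eq F N u v h).

Definition mean_curvature {r} (F : surface r) (u v : R) : R :=
  (k1 F u v + k2 F u v) / 2.

Definition gauss_curvature {r} (F : surface r) (u v : R) : R :=
  k1 F u v * k2 F u v.

Definition constant_on (D : R * R -> Prop) (f : R -> R -> R) : Prop :=
  exists c, forall u v, D (u, v) -> f u v = c.

Lemma area_neq0 {r} (F : surface r) u v : dom F (u, v) -> area F u v <> 0.
Proof.
intros Hd E; apply (pos_immersed r F u v Hd).
rewrite !(d_pos r F u v _ Hd).
unfold area in E.
destruct (e1 F u v) as [[a1 a2] a3], (e2 F u v) as [[b1 b2] b3].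
unfold cross, plus, scal, zero; cbn.
unfold plus, scal, mult; cbn; unfold mult, prod_zero, zero; cbn.
unfold prod_zero, zero; cbn.
set (p := w1 F u v du) in *; set (q := w2 F u v dv) in *.
set (s := w1 F u v dv) in *; set (t := w2 F u v du) in *.
f_equal; [f_equal|].
- replace 0 with ((p * q - s * t) * (a2 * b3 - a3 * b2)) by (rewrite E; ring); ring.
- replace 0 with ((p * q - s * t) * (a3 * b1 - a1 * b3)) by (rewrite E; ring); ring.
- replace 0 with ((p * q - s * t) * (a1 * b2 - a2 * b1)) by (rewrite E; ring); ring.
Qed.

Lemma dot_comb_l (p q : R) (a b c : vec) :
  dot (plus (scal p a) (scal q b)) c = p * dot a c + q * dot b c.
Proof.
destruct a as [[a1 a2] a3], b as [[b1 b2] b3], c as [[c1 c2] c3].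
unfold dot, plus, scal; cbn; unfold plus, scal, mult; cbn; unfold mult; cbn.
ring.
Qed.

Lemma dot_vdiff X u v h c :
  dot (vdiff X u v h) c =
  fst h * dot (vdiff X u v du) c + snd h * dot (vdiff X u v dv) c.
Proof. unfold dot, vdiff, diff; cbn; ring. Qed.

Lemma w1_linear {r} (F : surface r) u v h : dom F (u, v) ->
  w1 F u v h = fst h * w1 F u v du + snd h * w1 F u v dv.
Proof.
intros Hd.
destruct (frame_orthonormal r F u v Hd) as (H11 & H22 & H33 & H12 & H13 & H23).
assert (H21 : dot (e2 F u v) (e1 F u v) = 0)
  by (rewrite <- H12; unfold dot; ring).
assert (E : forall g, dot (vdiff (pos F) u v g) (e1 F u v) = w1 F u v g).
{ intros g; rewrite (d_pos r F u v g Hd), dot_comb_l, H11, H21; ring. }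
rewrite <- !E; apply dot_vdiff.
Qed.

Lemma w2_linear {r} (F : surface r) u v h : dom F (u, v) ->
  w2 F u v h = fst h * w2 F u v du + snd h * w2 F u v dv.
Proof.
intros Hd.
destruct (frame_orthonormal r F u v Hd) as (H11 & H22 & H33 & H12 & H13 & H23).
assert (E : forall g, dot (vdiff (pos F) u v g) (e2 F u v) = w2 F u v g).
{ intros g; rewrite (d_pos r F u v g Hd), dot_comb_l, H12, H22; ring. }
rewrite <- !E; apply dot_vdiff.
Qed.

Lemma nabla_spec {r} (F : surface r) f u v h : dom F (u, v) ->
  diff f u v h =
  nabla1 F f u v * w1 F u v h + nabla2 F f u v * w2 F u v h.
Proof.
intros Hd; assert (A := area_neq0 F u v Hd).
rewrite (w1_linear F u v h Hd), (w2_linear F u v h Hd).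
replace (diff f u v h)
  with (fst h * diff f u v du + snd h * diff f u v dv)
  by (unfold diff; cbn; ring).
unfold nabla1, nabla2; unfold area in *; field; exact A.
Qed.

Lemma nabla_unique {r} (F : surface r) f u v a b : dom F (u, v) ->
  (forall h, diff f u v h = a * w1 F u v h + b * w2 F u v h) ->
  a = nabla1 F f u v /\ b = nabla2 F f u v.
Proof.
intros Hd E; assert (A := area_neq0 F u v Hd).
unfold nabla1, nabla2; rewrite !E; unfold area in *; split; field; exact A.
Qed.

(* If the net has distinct directions (a1, b1), (a2, b2) with respect to (w1, w2),
   they are orthogonal iff A + C = 0 (take l = m = 1) and conjugate iff
   k2 A + k1 C = 0 (take l = k1, m = k2). *)
Lemma net_directions (l m A B C a1 b1 a2 b2 : R) :
  ~ (A = 0 /\ B = 0 /\ C = 0) -> a1 * b2 - a2 * b1 <> 0 ->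
  A * a1 ^ 2 + 2 * B * (a1 * b1) + C * b1 ^ 2 = 0 ->
  A * a2 ^ 2 + 2 * B * (a2 * b2) + C * b2 ^ 2 = 0 ->
  (m * A + l * C = 0 <-> l * (a1 * a2) + m * (b1 * b2) = 0).
Proof.
intros HN HD E1 E2.
set (d := a1 * b2 - a2 * b1) in *.
set (p := A * (a1 * a2) + B * (a1 * b2 + a2 * b1) + C * (b1 * b2)).
assert (Hd : d ^ 2 <> 0) by (apply pow_nonzero; exact HD).
assert (EA : A * d ^ 2 = -2 * p * (b1 * b2)).
{ transitivity (-2 * p * (b1 * b2)
    + b2 ^ 2 * (A * a1 ^ 2 + 2 * B * (a1 * b1) + C * b1 ^ 2)
    + b1 ^ 2 * (A * a2 ^ 2 + 2 * B * (a2 * b2) + C * b2 ^ 2)).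
  - unfold p, d; ring.
  - rewrite E1, E2; ring. }
assert (EC : C * d ^ 2 = -2 * p * (a1 * a2)).
{ transitivity (-2 * p * (a1 * a2)
    + a2 ^ 2 * (A * a1 ^ 2 + 2 * B * (a1 * b1) + C * b1 ^ 2)
    + a1 ^ 2 * (A * a2 ^ 2 + 2 * B * (a2 * b2) + C * b2 ^ 2)).
  - unfold p, d; ring.
  - rewrite E1, E2; ring. }
assert (EB : B * d ^ 2 = p * (a1 * b2 + a2 * b1)).
{ transitivity (p * (a1 * b2 + a2 * b1)
    - a2 * b2 * (A * a1 ^ 2 + 2 * B * (a1 * b1) + C * b1 ^ 2)
    - a1 * b1 * (A * a2 ^ 2 + 2 * B * (a2 * b2) + C * b2 ^ 2)).
  - unfold p, d; ring.
  - rewrite E1, E2; ring. }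
assert (Hp : p <> 0).
{ intros H0; apply HN; rewrite H0 in EA, EB, EC.
  repeat split; apply (Rmult_eq_reg_r (d ^ 2)); trivial; lra. }
assert (E : (m * A + l * C) * d ^ 2
            = -2 * p * (l * (a1 * a2) + m * (b1 * b2))).
{ transitivity (m * (A * d ^ 2) + l * (C * d ^ 2)); [ring|].
  rewrite EA, EC; ring. }
split; intros H; rewrite H in E.
- apply (Rmult_eq_reg_l (-2 * p)); [lra|].
  apply Rmult_integral_contrapositive_currified; [lra|exact Hp].
- apply (Rmult_eq_reg_r (d ^ 2)); [lra|exact Hd].
Qed.

(* Main.v *)
(* The Codazzi equations nabla2 k1 = (k1 - k2) q1 and nabla1 k2 = (k1 - k2) q2 turn
   the orthogonality of the two nets into q1 nabla1 H = q2 nabla2 H = 0 for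
   H = (k1 + k2) / 2, and their conjugacy into q1 nabla1 K = q2 nabla2 K = 0 for
   K = k1 k2.  Where q1 or q2 vanishes, Codazzi and nabla1 k1, nabla2 k2 <> 0 make
   the corresponding cross derivative of H or K nonzero; by connectedness q1 and q2
   then vanish nowhere unless F is moulding, so H or K has zero differential.
   The normal of the central surface F^(i) is +e_i or -e_i, and Rodrigues' formula
   for it gives the equation of the i-th net. *)
From Stdlib Require Import Reals Lra Lia.
From Coquelicot Require Import Coquelicot.
Require Import Defs.

(** * Differentials and functions of class C^n on an open set of parameters *)

Lemma open_near (D : R * R -> Prop) u v :
  open D -> D (u, v) -> locally_2d (fun a b => D (a, b)) u v.
Proof.
intros HD Huv; apply locally_2d_locally.
generalize (HD _ Huv); apply filter_imp; intros [a b]; trivial.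
Qed.

Lemma open_near_eq (D : R * R -> Prop) (f g : R -> R -> R) u v :
  open D -> D (u, v) -> (forall a b, D (a, b) -> f a b = g a b) ->
  locally_2d (fun a b => f a b = g a b) u v.
Proof.
intros HD Huv E; destruct (open_near D u v HD Huv) as [d Hd].
exists d; intros a b Ha Hb; apply E, Hd; trivial.
Qed.

Lemma diff_ext_loc (f g : R -> R -> R) u v h :
  locally_2d (fun a b => f a b = g a b) u v -> diff f u v h = diff g u v h.
Proof.
intros E; unfold diff; f_equal; f_equal; apply Derive_ext_loc.
- exact (locally_2d_1d_const_y _ u v E).
- exact (locally_2d_1d_const_x _ u v E).
Qed.

(** The identities of a [surface] hold on its domain only; since the domain is open, they hold near
    each of its points and can be differentiated there. *)
Lemma diff_ext (D : R * R -> Prop) (f g : R -> R -> R) u v h :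
  open D -> D (u, v) -> (forall a b, D (a, b) -> f a b = g a b) ->
  diff f u v h = diff g u v h.
Proof. intros HD Huv E; apply diff_ext_loc, (open_near_eq D); trivial. Qed.

(** Existence of the two partial derivatives, weaker than differentiability in the plane. As [diff]
    is assembled from partial derivatives, this is enough for the sum, product and quotient
    rules. *)
Definition differentiable_uv (f : R -> R -> R) (u v : R) : Prop :=
  ex_derive (fun z => f z v) u /\ ex_derive (fun z => f u z) v.

Lemma diff_const c u v h : diff (fun _ _ => c) u v h = 0.
Proof. unfold diff; rewrite !Derive_const; ring. Qed.

Lemma diff_plus f g u v h : differentiable_uv f u v -> differentiable_uv g u v ->
  diff (fun a b => f a b + g a b) u v h = diff f u v h + diff g u v h.
Proof. intros [? ?] [? ?]; unfold diff; 
rewrite (Derive_plus (fun z : R => f z v) (fun z : R => g z v)),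
  (Derive_plus (fun z : R => f u z) (fun z : R => g u z)); trivial; ring. Qed.

Lemma diff_mult f g u v h : differentiable_uv f u v -> differentiable_uv g u v ->
  diff (fun a b => f a b * g a b) u v h
  = diff f u v h * g u v + f u v * diff g u v h.
Proof. intros [? ?] [? ?]; unfold diff; 
rewrite (Derive_mult (fun z : R => f z v) (fun z : R => g z v)),
  (Derive_mult (fun z : R => f u z) (fun z : R => g u z)); trivial; ring. Qed.

Lemma diff_inv f u v h : differentiable_uv f u v -> f u v <> 0 ->
  diff (fun a b => / f a b) u v h = - diff f u v h / f u v ^ 2.
Proof.
intros [H1 H2] H0; unfold diff; 
rewrite (Derive_inv (fun z : R => f z v)), (Derive_inv (fun z : R => f u z)); trivial.
field; exact H0.
Qed.

Lemma class_C_ext n (D : R * R -> Prop) f g : open D ->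
  (forall u v, D (u, v) -> f u v = g u v) -> class_C n D f -> class_C n D g.
Proof.
intros HD E Hf u v Huv.
apply (ex_diff_n_ext_loc f); [apply (open_near_eq D)|apply Hf]; trivial.
Qed.

Lemma class_C_le m n D f : (m <= n)%nat -> class_C n D f -> class_C m D f.
Proof. intros L Hf u v Huv; apply (ex_diff_n_m n); [exact L|apply Hf, Huv]. Qed.

Lemma class_C_continuity n D f u v : class_C n D f -> D (u, v) ->
  continuity_2d_pt f u v.
Proof. intros Hf Huv; generalize (Hf u v Huv); destruct n; intros H; apply H. Qed.

Lemma class_C_differentiable n D f u v : class_C (S n) D f -> D (u, v) ->
  differentiable_uv f u v.
Proof. intros Hf Huv; destruct (Hf u v Huv) as (_ & ? & ? & _); split; trivial. Qed.

Lemma class_C_const n D c : class_C n D (fun _ _ => c).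
Proof.
revert c; induction n as [|n IH]; intros c u v Huv; split;
  try apply continuity_2d_pt_const; trivial.
repeat split; try apply ex_derive_const.
- apply (ex_diff_n_ext_loc (fun _ _ => 0)); [|apply IH, Huv].
  exists (mkposreal 1 Rlt_0_1); intros; rewrite Derive_const; trivial.
- apply (ex_diff_n_ext_loc (fun _ _ => 0)); [|apply IH, Huv].
  exists (mkposreal 1 Rlt_0_1); intros; rewrite Derive_const; trivial.
Qed.

Lemma class_C_partial_u n D f : class_C (S n) D f ->
  class_C n D (fun u v => Derive (fun z => f z v) u).
Proof. intros Hf u v Huv; apply (Hf u v Huv). Qed.

Lemma class_C_partial_v n D f : class_C (S n) D f ->
  class_C n D (fun u v => Derive (fun z => f u z) v).
Proof. intros Hf u v Huv; apply (Hf u v Huv). Qed.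

(** Raises the class from explicit formulas [fu], [fv] for the partial derivatives. They are valid
    on all of the open set [D], so they agree locally with the [Derive] terms inside [ex_diff_n]. *)
Lemma class_C_succ n D f fu fv : open D -> class_C 0 D f ->
  (forall u v, D (u, v) ->
    is_derive (fun z => f z v) u (fu u v) /\ is_derive (fun z => f u z) v (fv u v)) ->
  class_C n D fu -> class_C n D fv -> class_C (S n) D f.
Proof.
intros HD H0 Hd Hu Hv u v Huv.
split; [apply (H0 u v Huv)|].
split; [exists (fu u v); apply Hd, Huv|split; [exists (fv u v); apply Hd, Huv|split]].
- refine (class_C_ext n D fu _ HD _ Hu u v Huv).
  intros a b Hab; symmetry; apply is_derive_unique, Hd, Hab.
- refine (class_C_ext n D fv _ HD _ Hv u v Huv).
  intros a b Hab; symmetry; apply is_derive_unique, Hd, Hab.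
Qed.

Lemma class_C_plus n D f g : open D -> class_C n D f -> class_C n D g ->
  class_C n D (fun u v => f u v + g u v).
Proof.
intros HD; revert f g; induction n as [|n IH]; intros f g Hf Hg.
- intros u v Huv; split; trivial.
  apply continuity_2d_pt_plus; eapply class_C_continuity; eauto.
- apply (class_C_succ n D _ (fun u v => Derive (fun z => f z v) u + Derive (fun z => g z v) u)
     (fun u v => Derive (fun z => f u z) v + Derive (fun z => g u z) v) HD).
  + intros u v Huv; split; trivial.
    apply continuity_2d_pt_plus; eapply class_C_continuity; eauto.
  + intros u v Huv.
    destruct (class_C_differentiable n D f u v Hf Huv).
    destruct (class_C_differentiable n D g u v Hg Huv).
    split; apply (is_derive_plus (V := R_NormedModule)); apply Derive_correct; trivial.
  + apply IH; apply class_C_partial_u; trivial.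
  + apply IH; apply class_C_partial_v; trivial.
Qed.

Lemma class_C_mult n D f g : open D -> class_C n D f -> class_C n D g ->
  class_C n D (fun u v => f u v * g u v).
Proof.
intros HD; revert f g; induction n as [|n IH]; intros f g Hf Hg.
- intros u v Huv; split; trivial.
  apply continuity_2d_pt_mult; eapply class_C_continuity; eauto.
(* The partial derivatives of a product again contain [f] and [g], so the induction hypothesis has
   to be fed with [f] and [g] lowered to class C^n. *)
- assert (Hf' := class_C_le n (S n) D f (le_S _ _ (le_n n)) Hf).
  assert (Hg' := class_C_le n (S n) D g (le_S _ _ (le_n n)) Hg).
  apply (class_C_succ n D _
     (fun u v => Derive (fun z => f z v) u * g u v + f u v * Derive (fun z => g z v) u)
     (fun u v => Derive (fun z => f u z) v * g u v + f u v * Derive (fun z => g u z) v) HD).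
  + intros u v Huv; split; trivial.
    apply continuity_2d_pt_mult; eapply class_C_continuity; eauto.
  + intros u v Huv.
    destruct (class_C_differentiable n D f u v Hf Huv).
    destruct (class_C_differentiable n D g u v Hg Huv).
    split.
    * apply (is_derive_mult (fun z => f z v) (fun z => g z v));
        try (apply Derive_correct; trivial); exact Rmult_comm.
    * apply (is_derive_mult (fun z => f u z) (fun z => g u z));
        try (apply Derive_correct; trivial); exact Rmult_comm.
  + apply class_C_plus; trivial; apply IH; trivial; apply class_C_partial_u; trivial.
  + apply class_C_plus; trivial; apply IH; trivial; apply class_C_partial_v; trivial.
Qed.

Lemma class_C_opp n D f : open D -> class_C n D f -> class_C n D (fun u v => - f u v).
Proof.
intros HD Hf; apply (class_C_ext n D (fun u v => -1 * f u v)); trivial.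
- intros; ring.
- apply class_C_mult; trivial; apply class_C_const.
Qed.

Lemma class_C_minus n D f g : open D -> class_C n D f -> class_C n D g ->
  class_C n D (fun u v => f u v - g u v).
Proof. intros; apply class_C_plus; trivial; apply class_C_opp; trivial. Qed.

Lemma class_C_inv n D f : open D -> (forall u v, D (u, v) -> f u v <> 0) ->
  class_C n D f -> class_C n D (fun u v => / f u v).
Proof.
intros HD H0; revert f H0; induction n as [|n IH]; intros f H0 Hf.
- intros u v Huv; split; trivial.
  apply continuity_2d_pt_inv; [eapply class_C_continuity|]; eauto.
- assert (Hf' := class_C_le n (S n) D f (le_S _ _ (le_n n)) Hf).
  (* The factor 1/f^2 is written as a product of two inverses, so that the induction hypothesis
     covers it. *)
  apply (class_C_succ n D _
     (fun u v => - Derive (fun z => f z v) u * (/ f u v * / f u v))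
     (fun u v => - Derive (fun z => f u z) v * (/ f u v * / f u v)) HD).
  + intros u v Huv; split; trivial.
    apply continuity_2d_pt_inv; [eapply class_C_continuity|]; eauto.
  + intros u v Huv.
    destruct (class_C_differentiable n D f u v Hf Huv).
    assert (Hn := H0 u v Huv).
    split.
    * replace (- _ * _) with (- Derive (fun z => f z v) u / f u v ^ 2)
        by (field; exact Hn).
      apply (is_derive_inv (fun z => f z v)); [apply Derive_correct|]; trivial.
    * replace (- _ * _) with (- Derive (fun z => f u z) v / f u v ^ 2)
        by (field; exact Hn).
      apply (is_derive_inv (fun z => f u z)); [apply Derive_correct|]; trivial.
  + apply class_C_mult; trivial; [apply class_C_opp; trivial; apply class_C_partial_u; trivial|].
    apply class_C_mult; trivial; apply IH; trivial.
  + apply class_C_mult; trivial; [apply class_C_opp; trivial; apply class_C_partial_v; trivial|].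
    apply class_C_mult; trivial; apply IH; trivial.
Qed.

Lemma class_C_diff n D f h : open D -> class_C (S n) D f ->
  class_C n D (fun u v => diff f u v h).
Proof.
intros HD Hf; unfold diff.
apply class_C_plus; trivial; apply class_C_mult; trivial; try apply class_C_const.
- apply class_C_partial_u; trivial.
- apply class_C_partial_v; trivial.
Qed.

(** Schwarz's theorem; it is what makes d(df) vanish in the computation of exterior derivatives. *)
Lemma diff_comm D f u v : open D -> class_C 2 D f -> D (u, v) ->
  diff (fun a b => diff f a b dv) u v du = diff (fun a b => diff f a b du) u v dv.
Proof.
intros HD Hf Huv.
assert (E1 : forall a b, diff f a b du = Derive (fun z => f z b) a)
  by (intros; unfold diff; cbn; ring).
assert (E2 : forall a b, diff f a b dv = Derive (fun z => f a z) b)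
  by (intros; unfold diff; cbn; ring).
rewrite (diff_ext D _ _ u v du HD Huv (fun a b _ => E2 a b)).
rewrite (diff_ext D _ _ u v dv HD Huv (fun a b _ => E1 a b)).
unfold diff; cbn; rewrite !Rmult_1_r, !Rmult_0_r, Rplus_0_r, Rplus_0_l.
destruct (Hf u v Huv) as (_ & _ & _ & Hu & Hv).
apply Schwarz.
- destruct (open_near D u v HD Huv) as [d Hd]; exists d; intros a b Ha Hb.
  destruct (Hf a b (Hd a b Ha Hb)) as (_ & ? & ? & Hu' & Hv').
  repeat split; trivial; [apply Hv'|apply Hu'].
- apply Hv.
- apply Hu.
Qed.

(** Near a point of [D], every other point is reached by two segments parallel to the axes, along
    which f is constant. So the set where f takes a given value is open in [D]; its complement in
    [D] is open by continuity, and connectedness excludes that both are nonempty. *)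
Lemma constant_of_diff_zero D f : open D -> connected D -> (exists p, D p) ->
  class_C 1 D f -> (forall u v h, D (u, v) -> diff f u v h = 0) -> constant_on D f.
Proof.
intros HD HC [[u0 v0] H0] Hf Hz.
assert (Hpu : forall u v, D (u, v) -> is_derive (fun z => f z v) u 0).
{ intros u v H; assert (E := Hz u v du H); unfold diff in E; cbn in E.
  replace 0 with (Derive (fun z => f z v) u) by lra.
  apply Derive_correct; apply (class_C_differentiable 0 D f u v Hf H). }
assert (Hpv : forall u v, D (u, v) -> is_derive (fun z => f u z) v 0).
{ intros u v H; assert (E := Hz u v dv H); unfold diff in E; cbn in E.
  replace 0 with (Derive (fun z => f u z) v) by lra.
  apply Derive_correct; apply (class_C_differentiable 0 D f u v Hf H). }
assert (line : forall g a b,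
  (forall x, Rmin a b <= x <= Rmax a b -> is_derive g x 0) -> g b = g a).
{ intros g a b H; destruct (MVT_gen g a b (fun _ => 0)) as (c & _ & E).
  - intros x Hx; apply H; lra.
  - intros x Hx; apply continuity_pt_filterlim, (ex_derive_continuous g); exists 0; auto.
  - lra. }
exists (f u0 v0); intros u v Huv.
destruct (Req_dec (f u v) (f u0 v0)) as [|Hne]; trivial; exfalso.
destruct (HC (fun p => D p /\ f (fst p) (snd p) = f u0 v0)
             (fun p => D p /\ f (fst p) (snd p) <> f u0 v0)) as (p & _ & [_ E] & [_ N]).
- intros [a b] [Hab E]; cbn in E.
  destruct (open_near D a b HD Hab) as [d Hd].
  exists d; intros [a' b'] [Ha Hb]; cbn in *.
  change (Rabs (a' - a) < d) in Ha; change (Rabs (b' - b) < d) in Hb.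
  split; [apply Hd; trivial|].
  (* Keeps both segments inside the square of radius [d] contained in [D]. *)
  assert (between : forall x y z, Rmin x y <= z <= Rmax x y ->
            Rabs (y - x) < d -> Rabs (z - x) < d).
  { intros x y z Hz1 Hz2; unfold Rmin, Rmax in Hz1; unfold Rabs in *.
    destruct (Rle_dec x y), (Rcase_abs (y - x)), (Rcase_abs (z - x)); lra. }
  assert (Zd : forall x, Rabs (x - x) < d)
    by (intros; rewrite Rminus_diag, Rabs_R0; apply cond_pos).
  transitivity (f a b'); [|transitivity (f a b); trivial].
  (* The corner of the path from (a, b) to (a', b') is (a, b'). *)
  + apply (line (fun z => f z b')); intros x Hx; apply Hpu, Hd; eauto.
  + apply (line (fun z => f a z)); intros x Hx; apply Hpv, Hd; eauto.
- intros [a b] [Hab N]; cbn in N.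
  assert (N' : f a b - f u0 v0 <> 0) by lra.
  assert (C : class_C 0 D (fun a b => f a b - f u0 v0)).
  { apply class_C_minus; trivial; [|apply class_C_const].
    apply (class_C_le 0 1); auto. }
  apply (continuity_2d_pt_neq_0 _ _ _ (class_C_continuity 0 D _ a b C Hab)) in N'.
  apply locally_2d_locally in N'.
  generalize (filter_and _ _ (HD _ Hab) N'); apply filter_imp.
  intros [x y] [H1 H2]; split; trivial; cbn in *; lra.
- intros p Hp; destruct (Req_dec (f (fst p) (snd p)) (f u0 v0)); [left|right]; auto.
- exists (u0, v0); auto.
- exists (u, v); auto.
- contradiction.
Qed.

(** * Vector algebra and differentials of vector functions *)

Ltac vec_eq := apply injective_projections; [apply injective_projections|]; cbn [fst snd].

Ltac vec_unfold := repeat match goal with a : vec |- _ => destruct a as [[? ?] ?] end;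
  unfold det3, dot, cross; cbn;
  repeat progress (unfold plus, scal, mult, prod_plus, prod_scal; cbn).

Lemma dot_comm (a b : vec) : dot a b = dot b a.
Proof. unfold dot; ring. Qed.

Lemma dot_comb_r (p q : R) (a b c : vec) :
  dot c (plus (scal p a) (scal q b)) = p * dot c a + q * dot c b.
Proof. rewrite dot_comm, dot_comb_l, (dot_comm a), (dot_comm b); ring. Qed.

Lemma cross_comb (p q s t : R) (a b : vec) :
  cross (plus (scal p a) (scal q b)) (plus (scal s a) (scal t b))
  = scal (p * t - s * q) (cross a b).
Proof. vec_unfold; vec_eq; ring. Qed.

Lemma det3_rotate (a b c : vec) : det3 a b c = det3 b c a.
Proof. vec_unfold; ring. Qed.

(* |a x b - c|^2 = |a x b|^2 - 2 det (a, b, c) + |c|^2 = 0, by Lagrange's identity. *)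
Lemma cross_orthonormal (a b c : vec) : dot a a = 1 -> dot b b = 1 -> dot c c = 1 ->
  dot a b = 0 -> det3 a b c = 1 -> cross a b = c.
Proof.
intros Ha Hb Hc Hab Hd.
assert (L : dot (cross a b) (cross a b) = dot a a * dot b b - dot a b ^ 2)
  by (vec_unfold; ring).
rewrite Ha, Hb, Hab in L; unfold det3 in Hd.
destruct (cross a b) as [[x y] z], c as [[x' y'] z'].
unfold dot in *; cbn in *.
assert (H : (x - x') ^ 2 + (y - y') ^ 2 + (z - z') ^ 2 = 0) by lra.
assert (Hx := pow2_ge_0 (x - x')); assert (Hy := pow2_ge_0 (y - y')).
assert (Hz := pow2_ge_0 (z - z')).
vec_eq; apply Rminus_diag_uniq, Rsqr_0_uniq; rewrite Rsqr_pow2; lra.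
Qed.

(** The quotient [s / Rabs s] is the sign of s; it becomes the orientation of the normal of a
    central surface. *)
Lemma normalize_scal (s : R) (a : vec) : dot a a = 1 ->
  normalize (scal s a) = scal (s / Rabs s) a.
Proof.
intros Ha; unfold normalize.
replace (dot (scal s a) (scal s a)) with (Rsqr s * dot a a)
  by (unfold Rsqr; vec_unfold; ring).
rewrite Ha, Rmult_1_r, sqrt_Rsqr_abs, scal_assoc; f_equal; apply Rmult_comm.
Qed.

Lemma vclass_C_dot n D X Y : open D -> vclass_C n D X -> vclass_C n D Y ->
  class_C n D (fun u v => dot (X u v) (Y u v)).
Proof.
intros HD (? & ? & ?) (? & ? & ?); unfold dot.
repeat apply class_C_plus; trivial; apply class_C_mult; trivial.
Qed.

Lemma vclass_C_le m n D X : (m <= n)%nat -> vclass_C n D X -> vclass_C m D X.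
Proof. intros L (? & ? & ?); repeat split; apply (class_C_le m n); trivial. Qed.

Lemma vclass_C_vdiff n D X h : open D -> vclass_C (S n) D X ->
  vclass_C n D (fun u v => vdiff X u v h).
Proof. intros HD (? & ? & ?); repeat split; cbn; apply class_C_diff; trivial. Qed.

Lemma differentiable_mult f g u v :
  differentiable_uv f u v -> differentiable_uv g u v ->
  differentiable_uv (fun a b => f a b * g a b) u v.
Proof.
intros [? ?] [? ?]; split.
- apply (ex_derive_mult (fun z => f z v) (fun z => g z v)); trivial.
- apply (ex_derive_mult (fun z => f u z) (fun z => g u z)); trivial.
Qed.

Lemma differentiable_plus f g u v :
  differentiable_uv f u v -> differentiable_uv g u v ->
  differentiable_uv (fun a b => f a b + g a b) u v.
Proof.
intros [? ?] [? ?]; split.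
- apply (ex_derive_plus (fun z => f z v) (fun z => g z v)); trivial.
- apply (ex_derive_plus (fun z => f u z) (fun z => g u z)); trivial.
Qed.

Lemma diff_dot D X Y u v h : vclass_C 1 D X -> vclass_C 1 D Y -> D (u, v) ->
  diff (fun a b => dot (X a b) (Y a b)) u v h
  = dot (vdiff X u v h) (Y u v) + dot (X u v) (vdiff Y u v h).
Proof.
intros (X1 & X2 & X3) (Y1 & Y2 & Y3) Huv.
assert (Hd := fun f H => class_C_differentiable 0 D f u v H Huv).
apply Hd in X1, X2, X3, Y1, Y2, Y3.
pose (m x y := fun a b : R => x a b * y a b : R).
assert (Hm : forall x y, differentiable_uv x u v -> differentiable_uv y u v ->
  differentiable_uv (m x y) u v) by (intros; apply differentiable_mult; trivial).
(* The rule is first proved for abstract component functions, where the scalar rules can be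
   rewritten, and then instantiated with the projections of [X] and [Y]. *)
assert (P : forall x1 x2 x3 y1 y2 y3, differentiable_uv x1 u v ->
  differentiable_uv x2 u v -> differentiable_uv x3 u v -> differentiable_uv y1 u v ->
  differentiable_uv y2 u v -> differentiable_uv y3 u v ->
  diff (fun a b => m x1 y1 a b + m x2 y2 a b + m x3 y3 a b) u v h
  = diff x1 u v h * y1 u v + x1 u v * diff y1 u v h
    + (diff x2 u v h * y2 u v + x2 u v * diff y2 u v h)
    + (diff x3 u v h * y3 u v + x3 u v * diff y3 u v h)).
{ intros.
  rewrite (diff_plus (fun a b => m x1 y1 a b + m x2 y2 a b) (m x3 y3)),
    (diff_plus (m x1 y1) (m x2 y2)); auto using differentiable_plus.
  unfold m; rewrite (diff_mult x1 y1), (diff_mult x2 y2), (diff_mult x3 y3); trivial. }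
refine (eq_trans (P _ _ _ _ _ _ X1 X2 X3 Y1 Y2 Y3) _).
unfold dot, vdiff; cbn [fst snd]; ring.
Qed.

(** Meant for the central surfaces, with [X] the position, f = 1/k_i and [Y] the unit normal. *)
Lemma vdiff_plus_scal D X f Y u v h :
  vclass_C 1 D X -> class_C 1 D f -> vclass_C 1 D Y -> D (u, v) ->
  vdiff (fun a b => plus (X a b) (scal (f a b) (Y a b))) u v h
  = plus (vdiff X u v h)
      (plus (scal (diff f u v h) (Y u v)) (scal (f u v) (vdiff Y u v h))).
Proof.
intros (X1 & X2 & X3) Hf (Y1 & Y2 & Y3) Huv.
assert (Hd := fun f H => class_C_differentiable 0 D f u v H Huv).
apply Hd in X1, X2, X3, Hf, Y1, Y2, Y3.
assert (E : forall x y, differentiable_uv x u v -> differentiable_uv y u v ->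
  diff (fun a b => plus (x a b) (scal (f a b) (y a b))) u v h
  = plus (diff x u v h) (plus (scal (diff f u v h) (y u v)) (scal (f u v) (diff y u v h)))).
{ intros x y Hx Hy.
  exact (eq_trans (diff_plus x (fun a b => f a b * y a b) u v h Hx
      (differentiable_mult f y u v Hf Hy)) (f_equal _ (diff_mult f y u v h Hf Hy))). }
unfold vdiff at 1; vec_eq; [apply (E (fun a b => fst (fst (X a b))) (fun a b => fst (fst (Y a b))))
  |apply (E (fun a b => snd (fst (X a b))) (fun a b => snd (fst (Y a b))))
  |apply (E (fun a b => snd (X a b)) (fun a b => snd (Y a b)))]; trivial.
Qed.

Lemma vdiff_ext_loc X Y u v h :
  locally_2d (fun a b => X a b = Y a b) u v -> vdiff X u v h = vdiff Y u v h.
Proof.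
intros [d Hd]; unfold vdiff; vec_eq; apply diff_ext_loc; exists d;
  intros; rewrite Hd; trivial.
Qed.

Lemma diff_scal c f u v h : diff (fun a b => c * f a b) u v h = c * diff f u v h.
Proof.
unfold diff.
rewrite (Derive_scal (fun z : R => f z v)), (Derive_scal (fun z : R => f u z)); ring.
Qed.

Lemma vdiff_scal c X u v h :
  vdiff (fun a b => scal c (X a b)) u v h = scal c (vdiff X u v h).
Proof.
unfold vdiff; vec_eq; exact (diff_scal c _ u v h).
Qed.

(** Values closer to f(u, v) than |f(u, v)| have the sign of f(u, v). A locally constant sign can be
    taken out of a differential. *)
Lemma continuity_same_sign f u v : continuity_2d_pt f u v -> f u v <> 0 ->
  locally_2d (fun a b => f a b / Rabs (f a b) = f u v / Rabs (f u v)) u v.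
Proof.
intros Hf H0; destruct (Hf (mkposreal _ (Rabs_pos_lt _ H0))) as [d Hd].
exists d; intros a b Ha Hb; specialize (Hd a b Ha Hb); cbn in Hd.
unfold Rabs in *.
destruct (Rcase_abs (f u v)), (Rcase_abs (f a b)),
  (Rcase_abs (f a b - f u v)); try lra; field; lra.
Qed.

(** * Exterior derivatives, and Rodrigues' condition in a moving frame *)

(** The value of dw on the pair ([du], [dv]), that is, the single coefficient of this 2-form in the
    parameters. *)
Definition exterior (w : form) (u v : R) : R :=
  diff (fun a b => w a b dv) u v du - diff (fun a b => w a b du) u v dv.

(** Differentiating w = dX . Y, the second derivatives of [X] cancel by Schwarz, and minus the wedge
    product of dX and dY remains. *)
Lemma exterior_dot D X Y w u v : open D -> vclass_C 2 D X -> vclass_C 1 D Y ->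
  (forall a b h, D (a, b) -> w a b h = dot (vdiff X a b h) (Y a b)) -> D (u, v) ->
  exterior w u v = dot (vdiff X u v dv) (vdiff Y u v du)
                   - dot (vdiff X u v du) (vdiff Y u v dv).
Proof.
intros HD HX HY E Huv; unfold exterior.
rewrite (diff_ext D _ _ u v du HD Huv (fun a b => E a b dv)).
rewrite (diff_ext D _ _ u v dv HD Huv (fun a b => E a b du)).
rewrite !(diff_dot D); trivial; try (apply vclass_C_vdiff; trivial).
assert (S : vdiff (fun a b => vdiff X a b dv) u v du
            = vdiff (fun a b => vdiff X a b du) u v dv).
{ destruct HX as (? & ? & ?); unfold vdiff; cbn [fst snd].
  vec_eq; apply (diff_comm D); trivial. }
rewrite S; ring.
Qed.

(** The rule d(- f w) = - f dw - df ^ w, meant for w31 = - k1 w1 and w32 = - k2 w2. *)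
Lemma exterior_scal D f w w' u v : open D ->
  class_C 1 D f -> (forall h, class_C 1 D (fun a b => w a b h)) ->
  (forall a b h, D (a, b) -> w' a b h = - f a b * w a b h) -> D (u, v) ->
  exterior w' u v = - f u v * exterior w u v
    - (diff f u v du * w u v dv - diff f u v dv * w u v du).
Proof.
intros HD Hf Hw E Huv; unfold exterior.
rewrite (diff_ext D _ (fun a b => -1 * (f a b * w a b dv)) u v du HD Huv)
  by (intros; rewrite E; trivial; ring).
rewrite (diff_ext D _ (fun a b => -1 * (f a b * w a b du)) u v dv HD Huv)
  by (intros; rewrite E; trivial; ring).
rewrite !diff_scal, (diff_mult f (fun a b => w a b dv)), (diff_mult f (fun a b => w a b du));
  try (apply (class_C_differentiable 0 D); trivial).
ring.
Qed.

(* With Y of differential alpha T + beta E, the unit normal is locally +N or -N,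
   so Rodrigues' condition says that dN and dY are proportional. *)
Lemma principal_direction_iff D Y T E N (alpha beta p q : form) :
  open D ->
  (forall u v, D (u, v) -> dot (T u v) (T u v) = 1 /\ dot (E u v) (E u v) = 1 /\
    dot (N u v) (N u v) = 1 /\ dot (T u v) (E u v) = 0 /\
    cross (T u v) (E u v) = N u v) ->
  (forall u v h, D (u, v) ->
    vdiff Y u v h = plus (scal (alpha u v h) (T u v)) (scal (beta u v h) (E u v))) ->
  (forall u v h, D (u, v) ->
    vdiff N u v h = plus (scal (p u v h) (T u v)) (scal (q u v h) (E u v))) ->
  class_C 0 D (fun u v => alpha u v du * beta u v dv - alpha u v dv * beta u v du) ->
  (forall u v, D (u, v) ->
    alpha u v du * beta u v dv - alpha u v dv * beta u v du <> 0) ->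
  forall u v h, D (u, v) ->
  (alpha u v h = 0 -> beta u v h = 0 -> p u v h = 0 /\ q u v h = 0) ->
  principal_direction Y u v h <-> p u v h * beta u v h = q u v h * alpha u v h.
Proof.
intros HD HO HY HN Hs Hs0 u v h Huv H0.
set (s := fun u v => alpha u v du * beta u v dv - alpha u v dv * beta u v du) in *.
set (eps := s u v / Rabs (s u v)).
assert (Heps : eps <> 0).
{ apply Rmult_integral_contrapositive_currified; [apply Hs0, Huv|].
  apply Rinv_neq_0_compat, Rabs_no_R0, Hs0, Huv. }
(* By [cross_comb] the cross product of the partial derivatives of [Y] is s N; normalizing leaves
   the sign of s, which near (u, v) equals its value [eps] there. *)
assert (L : locally_2d (fun a b => unit_normal Y a b = scal eps (N a b)) u v).
{ generalize (locally_2d_and _ _ u v (open_near D u v HD Huv)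
    (continuity_same_sign s u v (class_C_continuity 0 D s u v Hs Huv) (Hs0 u v Huv))).
  apply locally_2d_impl, locally_2d_forall; intros a b [Hab Es].
  destruct (HO a b Hab) as (_ & _ & HNN & _ & HC).
  unfold unit_normal; rewrite !HY, cross_comb, HC, normalize_scal by trivial.
  f_equal; exact Es. }
unfold principal_direction.
rewrite (vdiff_ext_loc _ _ u v h L), vdiff_scal, HN, HY by trivial.
destruct (HO u v Huv) as (HTT & HEE & _ & HTE & _).
assert (HET : dot (E u v) (T u v) = 0) by (rewrite dot_comm; trivial).
set (a := alpha u v h) in *; set (b := beta u v h) in *.
set (x := p u v h) in *; set (y := q u v h) in *.
assert (R1 : forall c z w : R, scal c (plus (scal z (T u v)) (scal w (E u v)))
  = plus (scal (c * z) (T u v)) (scal (c * w) (E u v)) :> vec)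
  by (intros; rewrite scal_distr_l, !scal_assoc; trivial).
split.
(* Scalar products with T and E compare coefficients: eps p = - k alpha and eps q = - k beta.
   Eliminating k gives the proportionality. *)
- intros [k Ek]; rewrite !R1 in Ek.
  assert (E1 := f_equal (fun c => dot c (T u v)) Ek).
  assert (E2 := f_equal (fun c => dot c (E u v)) Ek); cbv beta in E1, E2.
  rewrite !dot_comb_l, HTT, HET in E1; rewrite !dot_comb_l, HTE, HEE in E2.
  apply (Rmult_eq_reg_l eps); [|exact Heps].
  transitivity ((eps * x) * b); [ring|].
  replace (eps * x) with (- k * a) by lra.
  replace (eps * (y * a)) with ((eps * y) * a) by ring.
  replace (eps * y) with (- k * b) by lra; ring.
- intros Exy.
  destruct (Req_dec a 0) as [Ha|Ha]; [destruct (Req_dec b 0) as [Hb|Hb]|].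
  (* If dY(h) = 0, then also dN(h) = 0 by hypothesis, and any k will do. In the other two cases k is
     solved from a nonzero coefficient of dY(h). *)
  + destruct (H0 Ha Hb) as [Hx Hy]; exists 0.
    rewrite !R1, Ha, Hb, Hx, Hy; f_equal; f_equal; ring.
  + exists (- (eps * y / b)); rewrite !R1.
    assert (Hx : x = 0).
    { apply (Rmult_eq_reg_r b); [rewrite Exy, Ha; ring|exact Hb]. }
    rewrite Ha, Hx; f_equal; f_equal; [ring|field; exact Hb].
  + exists (- (eps * x / a)); rewrite !R1; f_equal; f_equal; [field; exact Ha|].
    apply (Rmult_eq_reg_r a); [|exact Ha].
    transitivity (eps * (y * a)); [ring|]; rewrite <- Exy; field; exact Ha.
Qed.

(** * Regularity of the frame, of its forms and of the curvatures *)

Lemma pos_class_3 {r} (F : surface r) : (4 <= r)%nat -> vclass_C 3 (dom F) (pos F).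
Proof. intros hr; apply (vclass_C_le 3 r); [lia|apply pos_class]. Qed.

Lemma frame_class {r} (F : surface r) : (4 <= r)%nat ->
  vclass_C 2 (dom F) (e1 F) /\ vclass_C 2 (dom F) (e2 F) /\ vclass_C 2 (dom F) (e3 F).
Proof.
intros hr; split; [|split]; apply (vclass_C_le 2 (r - 2)); try lia;
  [apply e1_class|apply e2_class|apply e3_class].
Qed.

Lemma frame_cross {r} (F : surface r) u v : dom F (u, v) ->
  cross (e1 F u v) (e2 F u v) = e3 F u v /\
  cross (e2 F u v) (e3 F u v) = e1 F u v /\
  cross (e3 F u v) (e1 F u v) = e2 F u v.
Proof.
intros Huv; destruct (frame_orthonormal r F u v Huv) as (? & ? & ? & ? & E13 & ?).
assert (Hdet := frame_det r F u v Huv).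
repeat split; apply cross_orthonormal; trivial.
- rewrite <- det3_rotate; exact Hdet.
- rewrite dot_comm; exact E13.
- rewrite det3_rotate; exact Hdet.
Qed.

Lemma frame_dots {r} (F : surface r) u v : dom F (u, v) ->
  (dot (e1 F u v) (e1 F u v) = 1 /\ dot (e1 F u v) (e2 F u v) = 0 /\
   dot (e1 F u v) (e3 F u v) = 0) /\
  (dot (e2 F u v) (e1 F u v) = 0 /\ dot (e2 F u v) (e2 F u v) = 1 /\
   dot (e2 F u v) (e3 F u v) = 0) /\
  (dot (e3 F u v) (e1 F u v) = 0 /\ dot (e3 F u v) (e2 F u v) = 0 /\
   dot (e3 F u v) (e3 F u v) = 1).
Proof.
intros Huv; destruct (frame_orthonormal r F u v Huv) as (? & ? & ? & ? & ? & ?).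
rewrite (dot_comm (e2 F u v) (e1 F u v)), (dot_comm (e3 F u v) (e1 F u v)),
  (dot_comm (e3 F u v) (e2 F u v)); repeat split; trivial.
Qed.

(** A [surface] postulates no regularity for its forms. These scalar products recover it from the
    position and the frame, and bring the forms into the shape that [exterior_dot] expects. *)
Lemma forms_eq_dot {r} (F : surface r) u v h : dom F (u, v) ->
  w1 F u v h = dot (vdiff (pos F) u v h) (e1 F u v) /\
  w2 F u v h = dot (vdiff (pos F) u v h) (e2 F u v) /\
  w31 F u v h = dot (vdiff (e3 F) u v h) (e1 F u v) /\
  w32 F u v h = dot (vdiff (e3 F) u v h) (e2 F u v) /\
  w12 F u v h = dot (vdiff (e1 F) u v h) (e2 F u v).
Proof.
intros Huv; destruct (frame_dots F u v Huv)
  as ((E11 & E12 & E13) & (E21 & E22 & E23) & (E31 & E32 & E33)).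
rewrite d_pos, d_e3, d_e1, !dot_comb_l, E11, E12, E21, E22, E32 by trivial.
repeat split; ring.
Qed.

Lemma forms_class {r} (F : surface r) h : (4 <= r)%nat ->
  class_C 2 (dom F) (fun u v => w1 F u v h) /\
  class_C 2 (dom F) (fun u v => w2 F u v h) /\
  class_C 1 (dom F) (fun u v => w31 F u v h) /\
  class_C 1 (dom F) (fun u v => w32 F u v h) /\
  class_C 1 (dom F) (fun u v => w12 F u v h).
Proof.
intros hr; assert (HD := dom_open r F).
destruct (frame_class F hr) as (C1 & C2 & C3).
assert (Hx := vclass_C_vdiff 2 _ _ h HD (pos_class_3 F hr)).
assert (H1 := vclass_C_vdiff 1 _ _ h HD C1); assert (H3 := vclass_C_vdiff 1 _ _ h HD C3).
assert (C1' := vclass_C_le 1 2 _ _ (le_S _ _ (le_n _)) C1).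
assert (C2' := vclass_C_le 1 2 _ _ (le_S _ _ (le_n _)) C2).
pose (E := fun u v => forms_eq_dot F u v h).
split; [|split; [|split; [|split]]];
  (eapply class_C_ext; [exact HD|intros u v Huv; symmetry; apply (E u v Huv)|]);
  apply vclass_C_dot; trivial.
Qed.

Lemma area_class {r} (F : surface r) : (4 <= r)%nat -> class_C 1 (dom F) (area F).
Proof.
intros hr; assert (HD := dom_open r F).
destruct (forms_class F du hr) as (A1 & A2 & _), (forms_class F dv hr) as (B1 & B2 & _).
apply (class_C_le 1 2); [lia|]; unfold area.
apply class_C_minus; trivial; apply class_C_mult; trivial.
Qed.

Lemma inv_area_class {r} (F : surface r) : (4 <= r)%nat ->
  class_C 1 (dom F) (fun u v => / area F u v).
Proof.
intros hr; apply class_C_inv;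
  [apply dom_open|intros; apply area_neq0|apply area_class]; trivial.
Qed.

(** Cramer's rule: wedging w31 = - k1 w1 with w2, and w32 = - k2 w2 with w1, gives k1 and k2 up to
    sign times [area], which vanishes nowhere. *)
Lemma curvature_class {r} (F : surface r) : (4 <= r)%nat ->
  class_C 1 (dom F) (k1 F) /\ class_C 1 (dom F) (k2 F).
Proof.
intros hr; assert (HD := dom_open r F).
destruct (forms_class F du hr) as (A1 & A2 & A3 & A4 & _).
destruct (forms_class F dv hr) as (B1 & B2 & B3 & B4 & _).
assert (Hi := inv_area_class F hr).
assert (L := fun f => class_C_le 1 2 (dom F) f (le_S _ _ (le_n _))).
apply L in A1, A2, B1, B2.
split; [apply (class_C_ext 1 _ (fun u v =>
     (w31 F u v dv * w2 F u v du - w31 F u v du * w2 F u v dv) * / area F u v))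
  |apply (class_C_ext 1 _ (fun u v =>
     (w32 F u v du * w1 F u v dv - w32 F u v dv * w1 F u v du) * / area F u v))];
  trivial; try (apply class_C_mult; trivial; apply class_C_minus; trivial;
    apply class_C_mult; trivial).
- intros u v Huv; rewrite !w31E by trivial.
  assert (A := area_neq0 F u v Huv); unfold area in *; field; exact A.
- intros u v Huv; rewrite !w32E by trivial.
  assert (A := area_neq0 F u v Huv); unfold area in *; field; exact A.
Qed.

Lemma nabla_class {r} (F : surface r) f : (4 <= r)%nat -> class_C 1 (dom F) f ->
  class_C 0 (dom F) (nabla1 F f) /\ class_C 0 (dom F) (nabla2 F f).
Proof.
intros hr Hf; assert (HD := dom_open r F).
destruct (forms_class F du hr) as (A1 & A2 & _), (forms_class F dv hr) as (B1 & B2 & _).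
assert (L := fun f => class_C_le 0 2 (dom F) f (le_S _ _ (le_S _ _ (le_n _)))).
apply L in A1, A2, B1, B2.
assert (Hi := class_C_le 0 1 _ _ (le_S _ _ (le_n _)) (inv_area_class F hr)).
assert (Hu := class_C_diff 0 _ f du HD Hf); assert (Hv := class_C_diff 0 _ f dv HD Hf).
split; unfold nabla1, nabla2; apply class_C_mult; trivial; apply class_C_minus; trivial;
  apply class_C_mult; trivial.
Qed.

(** * The Codazzi equations and the criterion for constancy *)

(** The exterior derivatives of w31 and w32 are computed twice: as scalar products of frame
    differentials, and from w31 = - k1 w1, w32 = - k2 w2 by the product rule. *)
Lemma codazzi {r} (F : surface r) u v : (4 <= r)%nat -> dom F (u, v) ->
  nabla2 F (k1 F) u v = (k1 F u v - k2 F u v) * q1 F u v /\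
  nabla1 F (k2 F) u v = (k1 F u v - k2 F u v) * q2 F u v.
Proof.
intros hr Huv; assert (HD := dom_open r F); assert (A := area_neq0 F u v Huv).
destruct (frame_class F hr) as (C1 & C2 & C3).
assert (Cp := vclass_C_le 2 3 _ _ (le_S _ _ (le_n _)) (pos_class_3 F hr)).
assert (L := fun X => vclass_C_le 1 2 (dom F) X (le_S _ _ (le_n _))).
apply L in C1, C2.
destruct (curvature_class F hr) as [K1 K2].
assert (X1 := exterior_dot _ _ _ (w1 F) u v HD Cp C1
  (fun a b h H => proj1 (forms_eq_dot F a b h H)) Huv).
assert (X2 := exterior_dot _ _ _ (w2 F) u v HD Cp C2
  (fun a b h H => proj1 (proj2 (forms_eq_dot F a b h H))) Huv).
assert (X3 := exterior_dot _ _ _ (w31 F) u v HD C3 C1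
  (fun a b h H => proj1 (proj2 (proj2 (forms_eq_dot F a b h H)))) Huv).
assert (X4 := exterior_dot _ _ _ (w32 F) u v HD C3 C2
  (fun a b h H => proj1 (proj2 (proj2 (proj2 (forms_eq_dot F a b h H))))) Huv).
assert (W1 : forall h, class_C 1 (dom F) (fun a b => w1 F a b h)).
{ intros h; apply (class_C_le 1 2); [lia|]; apply (forms_class F h hr). }
assert (W2 : forall h, class_C 1 (dom F) (fun a b => w2 F a b h)).
{ intros h; apply (class_C_le 1 2); [lia|]; apply (forms_class F h hr). }
(* [X1] and [X2], the structure equations for dw1 and dw2, eliminate the exterior derivatives still
   left in the second computation. *)
rewrite (exterior_scal _ (k1 F) (w1 F) (w31 F) u v HD K1 W1 (w31E r F) Huv), X1 in X3.
rewrite (exterior_scal _ (k2 F) (w2 F) (w32 F) u v HD K2 W2 (w32E r F) Huv), X2 in X4.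
clear X1 X2.
destruct (frame_dots F u v Huv)
  as ((E11 & E12 & E13) & (E21 & E22 & E23) & (E31 & E32 & E33)).
rewrite !d_pos, !d_e1, !d_e3, !dot_comb_l, !dot_comb_r, E12, E13, E22, E23 in X3 by trivial.
rewrite !d_pos, !d_e2, !d_e3, !dot_comb_l, !dot_comb_r, E11, E13, E21, E23 in X4 by trivial.
rewrite !w31E, !w32E, !w12E in X3, X4 by trivial.
unfold nabla1, nabla2; unfold area in *.
set (k1v := k1 F u v) in *; set (k2v := k2 F u v) in *.
(* Multiplying by [area] clears the denominators of the Pfaffian derivatives. *)
split; apply (Rmult_eq_reg_r (w1 F u v du * w2 F u v dv - w1 F u v dv * w2 F u v du));
  trivial; field_simplify; trivial; lra.
Qed.

Lemma q1_class {r} (F : surface r) : (4 <= r)%nat ->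
  class_C 1 (dom F) (q1 F).
Proof.
intros hr; assert (HD := dom_open r F).
destruct (forms_class F du hr) as (_ & A2 & _ & _ & A5).
destruct (forms_class F dv hr) as (_ & B2 & _ & _ & B5).
assert (Hi := inv_area_class F hr).
assert (L := fun f => class_C_le 1 2 (dom F) f (le_S _ _ (le_n _))).
apply L in A2, B2.
apply (class_C_ext 1 _ (fun u v =>
  (w12 F u v du * w2 F u v dv - w12 F u v dv * w2 F u v du) * / area F u v)); trivial.
- intros u v Huv; rewrite !w12E by trivial.
  assert (A := area_neq0 F u v Huv); unfold area in *; field; exact A.
- apply class_C_mult; trivial; apply class_C_minus; trivial; apply class_C_mult; trivial.
Qed.

(* The hypotheses force q1 and q2 to vanish at the same points, and the domain to be
   the union of the disjoint open sets q1 <> 0 and nabla1 f <> 0; the first one is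
   nonempty since F is not a moulding surface, so it is the whole domain. *)
Lemma constant_iff_pfaff {r} (F : surface r) f : (4 <= r)%nat ->
  class_C 1 (dom F) f -> ~ moulding F ->
  (forall u v, dom F (u, v) -> q2 F u v = 0 -> nabla1 F f u v <> 0) ->
  (forall u v, dom F (u, v) -> q1 F u v = 0 -> nabla2 F f u v <> 0) ->
  (forall u v, dom F (u, v) ->
    q1 F u v * nabla1 F f u v = 0 /\ q2 F u v * nabla2 F f u v = 0) <->
  constant_on (dom F) f.
Proof.
intros hr Hf HM N1 N2; assert (HD := dom_open r F); split.
- intros H.
  assert (Q12 : forall u v, dom F (u, v) -> q1 F u v = 0 -> q2 F u v = 0).
  { intros u v Huv Q; destruct (H u v Huv) as [_ E].
    apply Rmult_integral in E; destruct E as [|E]; trivial.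
    contradiction (N2 u v Huv Q). }
  assert (Z1 : forall u v, dom F (u, v) -> nabla1 F f u v = 0).
  { intros u v Huv; destruct (Req_dec (nabla1 F f u v) 0) as [|Hne]; trivial.
    (* If nabla1 f is nonzero at (u, v), then q1 vanishes identically: a point (a, b) with q1
       nonzero would make both open sets nonempty. *)
    exfalso; apply HM; left; intros a b Hab.
    destruct (Req_dec (q1 F a b) 0) as [|Q]; trivial; exfalso.
    assert (open_neq0 : forall g, class_C 0 (dom F) g ->
              open (fun p => dom F p /\ g (fst p) (snd p) <> 0)).
    { intros g Hg [x y] [Hxy Hn].
      apply filter_and; [apply HD, Hxy|].
      apply (locally_2d_locally (fun x y => g x y <> 0)).
      apply continuity_2d_pt_neq_0; [apply (class_C_continuity 0 (dom F))|]; trivial. }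
    destruct (dom_connected r F _ _
      (open_neq0 _ (class_C_le 0 1 _ _ (le_S _ _ (le_n _))
                      (q1_class F hr)))
      (open_neq0 _ (proj1 (nabla_class F f hr Hf)))) as ([x y] & Hxy & [_ U] & [_ V]).
    (* The two sets cover the domain: q1 = 0 forces q2 = 0 by [Q12], hence nabla1 f is nonzero by
       [N1]. *)
    - intros [x y] Hxy; cbn [fst snd].
      destruct (Req_dec (q1 F x y) 0) as [E|]; [right|left]; split; trivial.
      apply N1; auto.
    - exists (a, b); auto.
    - exists (u, v); auto.
    - destruct (Rmult_integral _ _ (proj1 (H x y Hxy))); contradiction. }
  apply constant_of_diff_zero; trivial; [apply (dom_connected r F)|apply (dom_nonempty r F)|].
  intros u v h Huv; rewrite (nabla_spec F), Z1 by trivial.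
  destruct (H u v Huv) as [_ E]; apply Rmult_integral in E.
  (* A zero of q2 would make nabla1 f nonzero, against [Z1]; so nabla2 f = 0. *)
  destruct E as [E|E]; [exact (False_ind _ (N1 u v Huv E (Z1 u v Huv)))|rewrite E; ring].
- intros [c Hc] u v Huv.
  assert (Z : forall h, diff f u v h = 0).
  { intros h; rewrite (diff_ext (dom F) f (fun _ _ => c) u v h HD Huv Hc).
    apply diff_const. }
  unfold nabla1, nabla2; rewrite !Z; unfold Rdiv; split; ring.
Qed.

(** * Differentials of the mean and Gaussian curvatures *)

Lemma diff_mean_curvature {r} (F : surface r) u v h : (4 <= r)%nat -> dom F (u, v) ->
  diff (mean_curvature F) u v h = (diff (k1 F) u v h + diff (k2 F) u v h) / 2.
Proof.
intros hr Huv; destruct (curvature_class F hr) as [K1 K2].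
rewrite (diff_ext (dom F) _ (fun a b => / 2 * (k1 F a b + k2 F a b)) u v h
  (dom_open r F) Huv) by (intros; unfold mean_curvature; field).
rewrite diff_scal, (diff_plus (k1 F) (k2 F));
  try (apply (class_C_differentiable 0 (dom F)); trivial); field.
Qed.

Lemma diff_gauss_curvature {r} (F : surface r) u v h : (4 <= r)%nat -> dom F (u, v) ->
  diff (gauss_curvature F) u v h
  = diff (k1 F) u v h * k2 F u v + k1 F u v * diff (k2 F) u v h.
Proof.
intros hr Huv; destruct (curvature_class F hr) as [K1 K2].
apply (diff_mult (k1 F) (k2 F)); apply (class_C_differentiable 0 (dom F)); trivial.
Qed.

Lemma nabla_mean_curvature {r} (F : surface r) u v : (4 <= r)%nat -> dom F (u, v) ->
  nabla1 F (mean_curvature F) u v = (nabla1 F (k1 F) u v + nabla1 F (k2 F) u v) / 2 /\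
  nabla2 F (mean_curvature F) u v = (nabla2 F (k1 F) u v + nabla2 F (k2 F) u v) / 2.
Proof.
intros hr Huv; assert (A := area_neq0 F u v Huv).
unfold nabla1, nabla2; rewrite !diff_mean_curvature by trivial; split; field; exact A.
Qed.

Lemma nabla_gauss_curvature {r} (F : surface r) u v : (4 <= r)%nat -> dom F (u, v) ->
  nabla1 F (gauss_curvature F) u v
  = nabla1 F (k1 F) u v * k2 F u v + k1 F u v * nabla1 F (k2 F) u v /\
  nabla2 F (gauss_curvature F) u v
  = nabla2 F (k1 F) u v * k2 F u v + k1 F u v * nabla2 F (k2 F) u v.
Proof.
intros hr Huv; assert (A := area_neq0 F u v Huv).
unfold nabla1, nabla2; rewrite !diff_gauss_curvature by trivial; split; field; exact A.
Qed.

(** * Lines of curvature of the central surfaces *)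

(** Follows from de3 = - k1 w1 e1 - k2 w2 e2. For k = k_i the component along e_i drops out, so e_i
    is normal to the i-th central surface. *)
Lemma vdiff_pos_scal_e3 {r} (F : surface r) k u v h : (4 <= r)%nat ->
  class_C 1 (dom F) k -> (forall a b, dom F (a, b) -> k a b <> 0) -> dom F (u, v) ->
  vdiff (fun a b => plus (pos F a b) (scal (/ k a b) (e3 F a b))) u v h
  = plus (scal (w1 F u v h * (1 - k1 F u v * / k u v)) (e1 F u v))
     (plus (scal (w2 F u v h * (1 - k2 F u v * / k u v)) (e2 F u v))
       (scal (- diff k u v h * (/ k u v * / k u v)) (e3 F u v))).
Proof.
intros hr Hk H0 Huv; assert (HD := dom_open r F).
destruct (frame_class F hr) as (_ & _ & C3).
rewrite (vdiff_plus_scal (dom F) (pos F) (fun a b => / k a b) (e3 F)); trivial;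
  [|apply (vclass_C_le 1 3); [lia|apply pos_class_3, hr]
   |apply class_C_inv; trivial|apply (vclass_C_le 1 2); [lia|exact C3]].
rewrite diff_inv, d_pos, d_e3, w31E, w32E; trivial;
  [|apply (class_C_differentiable 0 (dom F)); trivial|apply H0; trivial].
specialize (H0 u v Huv); set (d := diff k u v h) in *.
generalize (e1 F u v), (e2 F u v), (e3 F u v); intros x y z.
vec_unfold; vec_eq; field; exact H0.
Qed.

Lemma plus_scal_0_l (a b : vec) : plus (scal 0 a) b = b.
Proof. vec_unfold; vec_eq; ring. Qed.

Lemma one_minus_ratio_neq0 (a b : R) : b <> 0 -> b <> a -> 1 - a * / b <> 0.
Proof.
intros Hb Hab E; apply Hab; apply Rminus_diag_uniq.
replace (b - a) with (b * (1 - a * / b)) by (field; exact Hb); rewrite E; ring.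
Qed.

Lemma curvature_neq0 {r} (F : surface r) u v : no_parabolic_points F -> dom F (u, v) ->
  k1 F u v <> 0 /\ k2 F u v <> 0.
Proof.
intros hp Huv; specialize (hp u v Huv); split; intros E; apply hp; rewrite E; ring.
Qed.

(** Here dy = alpha e2 + beta e3 with normal e1, and de1 = w12 e2 - w31 e3. Rodrigues' condition w12
    beta = - w31 alpha becomes the equation of [net1] after multiplication by - k1^2. *)
Lemma central1_lines_of_curvature {r} (F : surface r) : (4 <= r)%nat ->
  no_parabolic_points F -> not_canal F ->
  lines_of_curvature_net F (net1 F) (central1 F).
Proof.
intros hr hp hc u v h Huv; assert (HD := dom_open r F).
destruct (curvature_class F hr) as [K1 K2].
assert (P := fun a b => curvature_neq0 F a b hp).
assert (L1 := fun f => class_C_le 0 1 (dom F) f (le_S _ _ (le_n _))).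
assert (Ki : class_C 0 (dom F) (fun a b => / k1 F a b))
  by (apply class_C_inv; auto; apply P).
set (alpha := fun a b h => w2 F a b h * (1 - k2 F a b * / k1 F a b)).
set (beta := fun a b h => - diff (k1 F) a b h * (/ k1 F a b * / k1 F a b)).
assert (Ha : forall g, class_C 0 (dom F) (fun a b => alpha a b g)).
{ intros g; apply class_C_mult; trivial.
  - apply (class_C_le 0 2); [lia|]; apply (forms_class F g hr).
  - apply class_C_minus; trivial; [apply class_C_const|].
    apply class_C_mult; auto. }
assert (Hb : forall g, class_C 0 (dom F) (fun a b => beta a b g)).
{ intros g; apply class_C_mult; trivial; [|apply class_C_mult; trivial].
  apply class_C_opp; trivial; apply class_C_diff; trivial. }
rewrite (principal_direction_iff (dom F) (central1 F) (e2 F) (e3 F) (e1 F) alpha beta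
  (w12 F) (fun a b g => - w31 F a b g)); trivial.
- destruct (P u v Huv) as [Hk _].
  assert (E : w12 F u v h * beta u v h - - w31 F u v h * alpha u v h
    = - (netA (net1 F) u v * w1 F u v h ^ 2
         + 2 * netB (net1 F) u v * (w1 F u v h * w2 F u v h)
         + netC (net1 F) u v * w2 F u v h ^ 2) / k1 F u v ^ 2).
  { unfold alpha, beta; rewrite w31E, w12E, (nabla_spec F (k1 F)) by trivial.
    cbn [netA netB netC net1]; field; exact Hk. }
  unfold net_eq; set (n := netA (net1 F) u v * _ + _ + _) in *; split; intros H.
  + replace n with (- k1 F u v ^ 2 * (- n / k1 F u v ^ 2)) by (field; exact Hk).
    rewrite <- E, H; ring.
  + rewrite H in E; apply Rminus_diag_uniq; rewrite E; field; exact Hk.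
- intros a b Hab; destruct (frame_orthonormal r F a b Hab) as (? & ? & ? & ? & ? & ?).
  destruct (frame_cross F a b Hab) as (_ & ? & _); auto.
- intros a b g Hab; destruct (P a b Hab) as [Hk _].
  unfold central1; rewrite (vdiff_pos_scal_e3 F (k1 F)); trivial; [|apply P].
  rewrite Rinv_r, Rminus_diag, Rmult_0_r, plus_scal_0_l; trivial.
- intros a b g Hab; apply d_e1, Hab.
- apply class_C_minus; trivial; apply class_C_mult; trivial.
(* Regularity of the central surface: the wedge of alpha and beta is nabla1 k1 times [area] times (1
   - k2 / k1) / k1^2, nonzero by [not_canal]. *)
- intros a b Hab; destruct (P a b Hab) as [Hk _], (hc a b Hab) as (Hne & Hn & _).
  replace (alpha a b du * beta a b dv - alpha a b dv * beta a b du)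
    with (nabla1 F (k1 F) a b * area F a b
          * ((1 - k2 F a b * / k1 F a b) * (/ k1 F a b * / k1 F a b))).
  + apply prod_neq_R0; [exact (prod_neq_R0 _ _ Hn (area_neq0 F a b Hab))|].
    apply prod_neq_R0; [apply one_minus_ratio_neq0; auto|].
    apply prod_neq_R0; apply Rinv_neq_0_compat, Hk.
  + assert (A := area_neq0 F a b Hab); unfold alpha, beta, nabla1; field; auto.
- destruct (P u v Huv) as [Hk _], (hc u v Huv) as (Hne & Hn & _).
  (* If dy(h) = 0, then w2(h) = 0 and dk1(h) = 0; the latter reduces to nabla1 k1 w1(h) = 0, so
     w1(h) = 0 and de1(h) = 0. *)
  intros E1 E2; apply Rmult_integral in E1, E2.
  destruct E1 as [E1|E1]; [|contradiction (one_minus_ratio_neq0 _ _ Hk Hne E1)].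
  destruct E2 as [E2|E2].
  2: { contradict E2; apply prod_neq_R0; apply Rinv_neq_0_compat, Hk. }
  rewrite (nabla_spec F), E1 in E2 by trivial.
  assert (E3 : w1 F u v h = 0) by (apply (Rmult_eq_reg_l (nabla1 F (k1 F) u v)); trivial; lra).
  rewrite w12E, w31E, E1, E3 by trivial; split; ring.
Qed.

(** The same argument with the frame taken in the cyclic order e3, e1, e2: dy = alpha e3 + beta e1
    with normal e2, and de2 = - w32 e3 - w12 e1. *)
Lemma central2_lines_of_curvature {r} (F : surface r) : (4 <= r)%nat ->
  no_parabolic_points F -> not_canal F ->
  lines_of_curvature_net F (net2 F) (central2 F).
Proof.
intros hr hp hc u v h Huv; assert (HD := dom_open r F).
destruct (curvature_class F hr) as [K1 K2].
assert (P := fun a b => curvature_neq0 F a b hp).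
assert (L1 := fun f => class_C_le 0 1 (dom F) f (le_S _ _ (le_n _))).
assert (Ki : class_C 0 (dom F) (fun a b => / k2 F a b))
  by (apply class_C_inv; auto; apply P).
set (alpha := fun a b h => - diff (k2 F) a b h * (/ k2 F a b * / k2 F a b)).
set (beta := fun a b h => w1 F a b h * (1 - k1 F a b * / k2 F a b)).
assert (Ha : forall g, class_C 0 (dom F) (fun a b => alpha a b g)).
{ intros g; apply class_C_mult; trivial; [|apply class_C_mult; trivial].
  apply class_C_opp; trivial; apply class_C_diff; trivial. }
assert (Hb : forall g, class_C 0 (dom F) (fun a b => beta a b g)).
{ intros g; apply class_C_mult; trivial.
  - apply (class_C_le 0 2); [lia|]; apply (forms_class F g hr).
  - apply class_C_minus; trivial; [apply class_C_const|].
    apply class_C_mult; auto. }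
rewrite (principal_direction_iff (dom F) (central2 F) (e3 F) (e1 F) (e2 F) alpha beta
  (fun a b g => - w32 F a b g) (fun a b g => - w12 F a b g)); trivial.
- destruct (P u v Huv) as [_ Hk].
  assert (E : - w32 F u v h * beta u v h - - w12 F u v h * alpha u v h
    = - (netA (net2 F) u v * w1 F u v h ^ 2
         + 2 * netB (net2 F) u v * (w1 F u v h * w2 F u v h)
         + netC (net2 F) u v * w2 F u v h ^ 2) / k2 F u v ^ 2).
  { unfold alpha, beta; rewrite w32E, w12E, (nabla_spec F (k2 F)) by trivial.
    cbn [netA netB netC net2]; field; exact Hk. }
  unfold net_eq; set (n := netA (net2 F) u v * _ + _ + _) in *; split; intros H.
  + replace n with (- k2 F u v ^ 2 * (- n / k2 F u v ^ 2)) by (field; exact Hk).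
    rewrite <- E, H; ring.
  + rewrite H in E; apply Rminus_diag_uniq; rewrite E; field; exact Hk.
- intros a b Hab; destruct (frame_dots F a b Hab) as ((? & ? & ?) & (? & ? & ?) & (? & ? & ?)).
  destruct (frame_cross F a b Hab) as (_ & _ & ?); auto.
- intros a b g Hab; destruct (P a b Hab) as [_ Hk].
  unfold central2; rewrite (vdiff_pos_scal_e3 F (k2 F)); trivial; [|apply P].
  rewrite Rinv_r, Rminus_diag, Rmult_0_r, plus_scal_0_l; trivial.
  apply plus_comm.
- intros a b g Hab; rewrite d_e2 by trivial; apply plus_comm.
- apply class_C_minus; trivial; apply class_C_mult; trivial.
- intros a b Hab; destruct (P a b Hab) as [_ Hk], (hc a b Hab) as (Hne & _ & Hn).
  replace (alpha a b du * beta a b dv - alpha a b dv * beta a b du)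
    with (nabla2 F (k2 F) a b * area F a b
          * ((1 - k1 F a b * / k2 F a b) * (/ k2 F a b * / k2 F a b))).
  + apply prod_neq_R0; [exact (prod_neq_R0 _ _ Hn (area_neq0 F a b Hab))|].
    apply prod_neq_R0; [apply one_minus_ratio_neq0; auto|].
    apply prod_neq_R0; apply Rinv_neq_0_compat, Hk.
  + assert (A := area_neq0 F a b Hab); unfold alpha, beta, nabla2; field; auto.
- destruct (P u v Huv) as [_ Hk], (hc u v Huv) as (Hne & _ & Hn).
  intros E2 E1; apply Rmult_integral in E1, E2.
  destruct E1 as [E1|E1].
  2: { contradiction (one_minus_ratio_neq0 _ _ Hk (not_eq_sym Hne) E1). }
  destruct E2 as [E2|E2].
  2: { contradict E2; apply prod_neq_R0; apply Rinv_neq_0_compat, Hk. }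
  rewrite (nabla_spec F), E1 in E2 by trivial.
  assert (E3 : w2 F u v h = 0) by (apply (Rmult_eq_reg_l (nabla2 F (k2 F) u v)); trivial; lra).
  rewrite w12E, w32E, E1, E3 by trivial; split; ring.
Qed.

Theorem proposition5 (r : nat) (hr : (4 <= r)%nat) (F : surface r)
    (hpar : no_parabolic_points F) (hcanal : not_canal F)
    (hmould : ~ moulding F) :
  lines_of_curvature_net F (net1 F) (central1 F) /\
  lines_of_curvature_net F (net2 F) (central2 F) /\
  ((orthogonal_net F (net1 F) /\ orthogonal_net F (net2 F)) <->
     constant_on (dom F) (mean_curvature F)) /\
  ((conjugate_net F (net1 F) /\ conjugate_net F (net2 F)) <->
     constant_on (dom F) (gauss_curvature F)).
Proof.
split; [apply central1_lines_of_curvature; trivial|].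
split; [apply central2_lines_of_curvature; trivial|].
destruct (curvature_class F hr) as [K1 K2]; assert (HD := dom_open r F).
split; rewrite <- (constant_iff_pfaff F); trivial.
(* By Codazzi, A + C equals 2 q1 nabla1 H for the first net and 2 q2 nabla2 H for the second, where
   H is the mean curvature. *)
- unfold orthogonal_net; cbn [net1 net2 netA netC]; split.
  + intros [H1 H2] u v Huv; specialize (H1 u v Huv); specialize (H2 u v Huv).
    destruct (nabla_mean_curvature F u v hr Huv) as [-> ->].
    destruct (codazzi F u v hr Huv) as [C1 C2]; rewrite C1, C2 in *; lra.
  + intros H; split; intros u v Huv; destruct (H u v Huv) as [H1 H2];
      destruct (nabla_mean_curvature F u v hr Huv) as [E1 E2]; rewrite E1, E2 in *;
      destruct (codazzi F u v hr Huv) as [C1 C2]; rewrite C1, C2 in *; lra.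
- unfold mean_curvature, Rdiv; apply class_C_mult; [| |apply class_C_const]; trivial.
  apply class_C_plus; trivial.
(* Where q2 = 0, Codazzi gives nabla1 k2 = 0, so nabla1 H is half of nabla1 k1; the next case is
   symmetric. *)
- intros u v Huv Q; destruct (nabla_mean_curvature F u v hr Huv) as [-> _].
  destruct (codazzi F u v hr Huv) as [_ ->], (hcanal u v Huv) as (_ & Hn & _).
  rewrite Q; lra.
- intros u v Huv Q; destruct (nabla_mean_curvature F u v hr Huv) as [_ ->].
  destruct (codazzi F u v hr Huv) as [-> _], (hcanal u v Huv) as (_ & _ & Hn).
  rewrite Q; lra.
(* By Codazzi, k2 A + k1 C equals q1 nabla1 K for the first net and q2 nabla2 K for the second,
   where K = k1 k2. *)
- unfold conjugate_net; cbn [net1 net2 netA netC]; split.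
  + intros [H1 H2] u v Huv; specialize (H1 u v Huv); specialize (H2 u v Huv).
    destruct (nabla_gauss_curvature F u v hr Huv) as [-> ->].
    destruct (codazzi F u v hr Huv) as [C1 C2]; rewrite C1, C2 in *; lra.
  + intros H; split; intros u v Huv; destruct (H u v Huv) as [H1 H2];
      destruct (nabla_gauss_curvature F u v hr Huv) as [E1 E2]; rewrite E1, E2 in *;
      destruct (codazzi F u v hr Huv) as [C1 C2]; rewrite C1, C2 in *; lra.
- apply class_C_mult; trivial.
(* Where q2 = 0, nabla1 K reduces to k2 nabla1 k1, which is nonzero because there are no parabolic
   points. *)
- intros u v Huv Q; destruct (nabla_gauss_curvature F u v hr Huv) as [-> _].
  destruct (codazzi F u v hr Huv) as [_ ->], (hcanal u v Huv) as (_ & Hn & _).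
  destruct (curvature_neq0 F u v hpar Huv) as [_ Hk].
  rewrite Q, !Rmult_0_r, Rplus_0_r.
  apply prod_neq_R0; trivial.
- intros u v Huv Q; destruct (nabla_gauss_curvature F u v hr Huv) as [_ ->].
  destruct (codazzi F u v hr Huv) as [-> _], (hcanal u v Huv) as (_ & _ & Hn).
  destruct (curvature_neq0 F u v hpar Huv) as [Hk _].
  rewrite Q, Rmult_0_r, Rmult_0_l, Rplus_0_l.
  apply prod_neq_R0; trivial.
Qed.
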